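(* Let $A\in\mathbb{Z}^{m\times m}$ be a non-degenerate symmetric matrix, let $f:\mathbb{R}^{m\times n}\to\mathbb{R}$ be such that $f(U)\exp(-\pi\operatorname{tr}(U^{T}AU))$ is a Schwartz function on $\mathbb{R}^{m\times n}$, let $\lambda\in\mathbb{Z}$, $H,K\in\mathbb{R}^{m\times n}$, and for $Z=X+iY\in\mathbb{H}_n$ put $$\vartheta_{H,K}(Z)=\det Y^{-\lambda/2}\sum_{U\in H+\mathbb{Z}^{m\times n}}f(UY^{1/2})\,\mathrm{e}\bigl(\operatorname{tr}(U^{T}AUZ)/2+\operatorname{tr}(K^{T}AU)\bigr).$$ Let $S\in\mathbb{Z}^{n\times n}$ be a symmetric matrix. Then for all $Z\in\mathbb{H}_n$ $$\vartheta_{H,K}(Z+S)=\mathrm{e}\bigl(-\operatorname{tr}(H^{T}AHS)/2-\operatorname{tr}(S_0 1_{nm}A_0H)/2\bigr)\,\vartheta_{H,\widetilde K}(Z),\qquad \widetilde K:=K+HS+\tfrac12A^{-1}A_01_{mn}S_0 .$$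
   Context: $\mathrm{e}(z):=\exp(2\pi i z)$. $\mathbb{H}_n=\{Z=X+iY: X,Y\in\mathbb{R}^{n\times n}\text{ symmetric},\ Y\text{ positive definite}\}$; $Y^{1/2}$ is the symmetric positive definite square root of $Y$. For a square integral matrix $M$, $M_0$ denotes the diagonal matrix with the same diagonal entries as $M$ (and zeros elsewhere). $1_{\mu\nu}$ is the $\mu\times\nu$ matrix all of whose entries equal $1$. *)

(* Defs.v *)
From mathcomp Require Import all_boot all_order all_algebra.
From mathcomp Require Import all_classical all_reals all_analysis.
From mathcomp.real_closed Require Export complex.
From mathcomp.analysis Require showcase.summability.

Set Implicit Arguments.
Unset Strict Implicit.
Unset Printing Implicit Defensive.

Import Order.TTheory GRing.Theory Num.Theory numFieldNormedType.Exports.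

Local Open Scope classical_set_scope.
Local Open Scope complex_scope.
Local Open Scope ring_scope.

Definition cexp (R : realType) (z : R[i]) : R[i] :=
  (expR (complex.Re z))%:C * (cos (complex.Im z) +i* sin (complex.Im z)).

Definition e2pi (R : realType) (z : R[i]) : R[i] :=
  cexp ((2 * pi)%:C * 'i%C * z).

Definition intmx (T : pzRingType) (m n : nat) (M : 'M[int]_(m, n)) :
  'M[T]_(m, n) := map_mx intr M.

Definition complexmx (R : realType) (m n : nat) (M : 'M[R]_(m, n)) :
  'M[R[i]]_(m, n) := map_mx (fun x : R => x%:C) M.

Definition remx (R : realType) (m n : nat) (Z : 'M[R[i]]_(m, n)) :
  'M[R]_(m, n) := map_mx (@complex.Re R) Z.

Definition immx (R : realType) (m n : nat) (Z : 'M[R[i]]_(m, n)) :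
  'M[R]_(m, n) := map_mx (@complex.Im R) Z.

(* M_0, as a matrix over an arbitrary ring *)
Definition diag_part (T : pzRingType) (n : nat) (M : 'M[int]_n) : 'M[T]_n :=
  diag_mx (\row_i (M i i)%:~R).

Definition posdef (R : realType) (n : nat) (M : 'M[R]_n) : Prop :=
  M^T = M /\ forall v : 'cV[R]_n, v != 0 -> 0 < (v^T *m M *m v) 0 0.

Definition siegel (R : realType) (n : nat) : set 'M[R[i]]_n :=
  [set Z | (remx Z)^T = remx Z /\ posdef (immx Z)].

(* The symmetric positive definite square root; [xget] returns the matrix
   satisfying the predicate, which is unique when [Y] is positive definite, and
   the default value 0 if there is none. *)
Definition sqrtmx (R : realType) (n : nat) (Y : 'M[R]_n) : 'M[R]_n :=
  xget 0 [set B : 'M[R]_n | posdef B /\ B *m B = Y].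

(* Iterated partial derivatives with respect to the matrix entries listed in
   [s]; a multi-index is encoded by listing each entry with multiplicity. *)
Definition partials (R : realType) (m n : nat) (s : seq ('I_m * 'I_n))
    (g : 'M[R]_(m, n) -> R) : 'M[R]_(m, n) -> R :=
  foldr (fun ij (h : 'M[R]_(m, n) -> R) =>
           fun x => derive h x (delta_mx ij.1 ij.2)) g s.

Definition smooth (R : realType) (m n : nat) (g : 'M[R]_(m, n) -> R) : Prop :=
  forall s : seq ('I_m * 'I_n),
    continuous (partials s g) /\
    forall (i : 'I_m) (j : 'I_n) (x : 'M[R]_(m, n)),
      derivable (partials s g) x (delta_mx i j).

Definition schwartz (R : realType) (m n : nat) (g : 'M[R]_(m, n) -> R) : Prop :=
  smooth g /\
  forall (alpha : 'I_m -> 'I_n -> nat) (s : seq ('I_m * 'I_n)),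
    exists C : R, forall x : 'M[R]_(m, n),
      `|(\prod_i \prod_j x i j ^+ alpha i j) * partials s g x| <= C.

(* Unconditional sum of a complex family: the limit of its finite partial sums
   along the directed set of finite subsets of the index type. *)
Definition csum (R : realType) (I : choiceType) (x : I -> R[i]) : R[i] :=
  @summability.sum I R[i] R[i]^o x.

(* The sum over U in H + Z^(m x n) is indexed by N = U - H in Z^(m x n). *)
Definition theta (R : realType) (m n : nat) (A : 'M[int]_m)
    (f : 'M[R]_(m, n) -> R) (lambda : int) (H K : 'M[R]_(m, n))
    (Z : 'M[R[i]]_n) : R[i] :=
  let Y := immx Z in
  ((\det Y) `^ (- lambda%:~R / 2))%:C *
  csum (fun N : 'M[int]_(m, n) =>
    let U := H + intmx R N in
    (f (U *m sqrtmx Y))%:C *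
    e2pi (\tr (complexmx (U^T *m intmx R A *m U) *m Z) / 2
          + (\tr (K^T *m intmx R A *m U))%:C)).

(* Main.v *)
(* Put U = H + N with N integral. Because A and S are symmetric and integral, the
   off-diagonal contributions to tr(N^T A N S) pair up, and x^2 = x mod 2 gives
   tr(N^T A N S) = tr(S_0 1_{nm} A_0 N) mod 2. Hence the N-th terms of the two
   series have phases differing by a constant independent of N, up to an
   integer. *)
Require Import Defs.
From mathcomp Require Import all_boot all_order all_algebra.
From mathcomp Require Import all_classical all_reals all_analysis.
From mathcomp Require Import ring.
Import Order.TTheory GRing.Theory Num.Theory numFieldNormedType.Exports.
Local Open Scope complex_scope.
Local Open Scope ring_scope.

(* The hypothesis on [point], the junk value of a divergent [lim], makes the
   identity hold without summability of [x]. *)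
Lemma sumZ (I : choiceType) (K : numFieldType) (V : normedModType K) (c : K)
    (x : I -> V) :
  c != 0 -> (point : V) = 0 ->
  summability.sum (fun i => c *: x i) = c *: summability.sum x.
Proof.
move=> c0 pt0; rewrite /summability.sum.
have totF := @summability.totally_filter I.
have -> : summability.partial_sum (fun i => c *: x i)
          = c *: (summability.partial_sum x : _ -> V).
  by apply/funext => J; rewrite /summability.partial_sum fctE -scaler_sumr.
have [cv|ncv] := pselect (cvg (summability.partial_sum x @ summability.totally)%classic).
  exact: limZr.
rewrite (dvgP ncv) pt0 scaler0 -[RHS]pt0; apply: dvgP.
by rewrite is_cvgZrE.
Qed.

Lemma csumZ (R : realType) (I : choiceType) (c : R[i]) (x : I -> R[i]) :
  c != 0 -> csum (fun i => c * x i) = c * csum x.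
Proof. by move=> c0; exact: (@sumZ I R[i] R[i]^o c x c0 erefl). Qed.

Lemma e2piD (R : realType) (z w : R[i]) : e2pi (z + w) = e2pi z * e2pi w.
Proof.
rewrite /e2pi /cexp mulrDr; move: (_ * z) (_ * w) => [a b] [c d].
rewrite expRD cosD sinD; simpc; congr (_ +i* _); ring.
Qed.

Lemma e2pi0 (R : realType) : e2pi (0 : R[i]) = 1.
Proof. by rewrite /e2pi /cexp mulr0 /= expR0 cos0 sin0; simpc. Qed.

Lemma e2pi_neq0 (R : realType) (z : R[i]) : e2pi z != 0.
Proof.
apply/eqP => e0; have := e2piD R z (- z).
by rewrite subrr e2pi0 e0 mul0r => /eqP; rewrite oner_eq0.
Qed.

Lemma e2pi_int (R : realType) (k : int) : e2pi (k%:~R : R)%:C = 1.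
Proof.
have e1 : e2pi (1 : R[i]) = 1.
  rewrite /e2pi /cexp mulr1; simpc.
  by rewrite /= mulr_natl expR0 cos2pi sin2pi mul1r mulr0.
have en (p : nat) : e2pi (p%:R : R[i]) = 1.
  by elim: p => [|p IH]; rewrite ?e2pi0 // -natr1 e2piD IH e1 mulr1.
rewrite rmorph_int; case: k => p; first exact: en.
have -> : (Negz p)%:~R = - p.+1%:R :> R[i] by rewrite NegzE mulrNz.
by rewrite -[LHS]mulr1 -[X in _ * X = _](en p.+1) -e2piD addNr e2pi0.
Qed.

(** Off-diagonal entries come in equal pairs [F i j], [F j i]. The induction peels off the first row
    and the first column, which agree by symmetry. *)
Lemma symmetric_sum_mod2 (n : nat) (F : 'I_n -> 'I_n -> int) :
  (forall i j, F i j = F j i) ->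
  (2 %| \sum_i \sum_j F i j - \sum_i F i i)%Z.
Proof.
elim: n F => [|n IH] F Fsym; first by rewrite !big_ord0.
have := IH (fun i j => F (lift ord0 i) (lift ord0 j)) (fun i j => Fsym _ _).
rewrite !(@big_ord_recl _ _ _ n).
under [X in _ + X - _]eq_bigr do rewrite big_ord_recl Fsym.
rewrite big_split /= => dvd2.
set a := F ord0 ord0; set b := \sum_i F ord0 _; set c := \sum_i \sum_j _ in dvd2 *.
set d := \sum_i _ in dvd2 *.
(* [a] is the corner, [b] the rest of the first row and also of the first column, [c] the sum of the
   remaining block and [d] its trace. *)
have -> : a + b + (b + c) - (a + d) = 2 * b + (c - d) by ring.
by rewrite rpredD // dvdz_mulr.
Qed.

Lemma sqr_mod2 (a : int) : (2 %| a * a - a)%Z.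
Proof.
elim/int_rec: a => // p IH.
  have -> : p.+1%:Z * p.+1%:Z - p.+1%:Z = (p%:Z * p%:Z - p%:Z) + 2 * p%:Z.
    by rewrite -addn1 PoszD; ring.
  by rewrite rpredD // dvdz_mulr.
have -> : - p.+1%:Z * - p.+1%:Z - - p.+1%:Z
          = (- p%:Z * - p%:Z - - p%:Z) + 2 * (p%:Z + 1).
  by rewrite -addn1 PoszD; ring.
by rewrite rpredD // dvdz_mulr.
Qed.

(** The ring is arbitrary because the formula serves both for the congruence over the integers and
    for its image over the reals. *)
Lemma trace_diag_ones (T : pzRingType) (m n : nat) (A : 'M[int]_m)
    (S : 'M[int]_n) (N : 'M[T]_(m, n)) :
  \tr (diag_part T S *m (const_mx 1 : 'M[T]_(n, m)) *m diag_part T A *m N)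
  = \sum_j \sum_i (S j j)%:~R * (A i i)%:~R * N i j.
Proof.
apply: eq_bigr => j _; rewrite mxE; apply: eq_bigr => i _.
by rewrite /diag_part mul_mx_diag mxE mul_diag_mx !mxE mulr1.
Qed.

Lemma trace_quadratic_mod2 (m n : nat) (A : 'M[int]_m) (S : 'M[int]_n)
    (N : 'M[int]_(m, n)) :
  A^T = A -> S^T = S ->
  (2 %| \tr (N^T *m A *m N *m S)
        - \tr (diag_part int S *m (const_mx 1 : 'M[int]_(n, m)) *m diag_part int A *m N))%Z.
Proof.
move=> Asym Ssym.
have Ms : (N^T *m A *m N)^T = N^T *m A *m N.
  by rewrite !trmx_mul trmxK Asym mulmxA.
have ME i j : (N^T *m A *m N) i j = \sum_p \sum_q N p i * A p q * N q j.
  rewrite exchange_big mxE; apply: eq_bigr => q _; rewrite mxE mulr_suml.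
  by apply: eq_bigr => p _; rewrite !mxE.
move: (_ *m N) Ms ME => M Msym ME.
have symE p (B : 'M[int]_p) : B^T = B -> forall i j, B i j = B j i.
  by move=> Bs i j; rewrite -{1}Bs mxE.
(* Symmetry is used twice: for the entries of [M] against those of [S], then inside each diagonal
   entry [M j j], where [A] is symmetric. *)
have d1 : (2 %| \tr (M *m S) - \sum_j M j j * S j j)%Z.
  rewrite [\tr _](_ : _ = \sum_i \sum_j M i j * S i j).
    apply: (@symmetric_sum_mod2 n (fun i j => M i j * S i j)) => i j.
    by rewrite (symE _ M) // (symE _ S).
  apply: eq_bigr => i _; rewrite mxE.
  by apply: eq_bigr => j _; rewrite (symE _ S).
have d2 j : (2 %| M j j - \sum_i N i j * A i i * N i j)%Z.
  rewrite ME.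
  apply: (@symmetric_sum_mod2 m (fun p q => N p j * A p q * N q j)) => p q.
  by rewrite (symE _ A) //; ring.
rewrite trace_diag_ones -(subrK (\sum_j M j j * S j j) (\tr _)) -addrA rpredD //.
rewrite -sumrB rpred_sum // => j _.
rewrite -(subrK (\sum_i N i j * A i i * N i j) (M j j)) mulrDl -addrA rpredD //.
  by rewrite dvdz_mulr.
rewrite mulr_suml -sumrB rpred_sum // => i _; rewrite !intz.
(* What remains is to replace the square of each [N i j] by [N i j] itself. *)
have -> : N i j * A i i * N i j * S j j - S j j * A i i * N i j
        = (N i j * N i j - N i j) * (S j j * A i i) by ring.
by rewrite dvdz_mulr ?sqr_mod2.
Qed.

(** Expand in [U = H + V], with [V] the real image of [N]. The summand [H *m T] of [L] absorbs the
    terms mixed in [H] and [V]; the summand with [invmx B] absorbs half of the linear trace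
    congruent to the quadratic term in [V]. The parts in [H] alone give the constant. *)
Lemma theta_phase_shift (R : realType) (m n : nat) (A : 'M[int]_m)
    (S : 'M[int]_n) (H K : 'M[R]_(m, n)) (N : 'M[int]_(m, n)) :
  A^T = A -> \det A != 0 -> S^T = S ->
  let J : 'M[R]_(n, m) := const_mx 1 in
  let B := intmx R A in let T := intmx R S in
  let A0 := diag_part R A in let S0 := diag_part R S in
  let U := H + intmx R N in
  let L := K + H *m T + 2^-1 *: (invmx B *m A0 *m const_mx 1 *m S0) in
  exists k : int,
  \tr (U^T *m B *m U *m T) / 2 + \tr (K^T *m B *m U) =
  - \tr (H^T *m B *m H *m T) / 2 - \tr (S0 *m J *m A0 *m H) / 2
  + \tr (L^T *m B *m U) + k%:~R.
Proof.
move=> Asym Adet Ssym J B T A0 S0 U L.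
have /dvdzP[k Ek] := trace_quadratic_mod2 _ _ A S N Asym Ssym.
exists k.
have Bsym : B^T = B by rewrite /B /intmx matrix.map_trmx Asym.
have Tsym : T^T = T by rewrite /T /intmx matrix.map_trmx Ssym.
have Bu : B \in unitmx by rewrite unitmxE det_map_mx unitfE intr_eq0.
pose V := intmx R N.
(* The factor 2 cancels against the halving in the phase, leaving the integer [k]. *)
have quad : \tr (V^T *m B *m V *m T) = \tr (S0 *m J *m A0 *m V) + 2 * k%:~R.
  have -> : V^T *m B *m V *m T = intmx R (N^T *m A *m N *m S).
    by rewrite /intmx !map_mxM -matrix.map_trmx.
  rewrite trace_map_mx (canRL (subrK _) Ek) rmorphD rmorphM /= mulrC addrC.
  congr (_ + _); rewrite !trace_diag_ones rmorph_sum; apply: eq_bigr => j _.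
  by rewrite rmorph_sum; apply: eq_bigr => i _; rewrite !rmorphM /= !intz mxE.
have linT (W : 'M[R]_(m, n)) : \tr ((H *m T)^T *m B *m W) = \tr (H^T *m B *m W *m T).
  by rewrite trmx_mul Tsym -!mulmxA mxtrace_mulC !mulmxA.
(* Transposition puts [invmx B] next to [B], so they cancel. *)
have corr : \tr ((invmx B *m A0 *m const_mx 1 *m S0)^T *m B *m U) = \tr (S0 *m J *m A0 *m U).
  rewrite !trmx_mul !tr_diag_mx trmx_const trmx_inv Bsym -!mulmxA.
  by rewrite (mulmxA (invmx B)) mulVmx // mul1mx.
have cross : \tr (V^T *m B *m H *m T) = \tr (H^T *m B *m V *m T).
  by rewrite -mxtrace_tr !trmx_mul trmxK Bsym Tsym mxtrace_mulC !mulmxA.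
have LE : \tr (L^T *m B *m U) =
    \tr (K^T *m B *m U) + \tr (H^T *m B *m U *m T) + 2^-1 * \tr (S0 *m J *m A0 *m U).
  have -> : L^T = K^T + (H *m T)^T + 2^-1 *: (invmx B *m A0 *m const_mx 1 *m S0)^T.
    by rewrite /L !linearD linearZ.
  by rewrite !mulmxDl !mxtraceD -!scalemxAl mxtraceZ corr linT.
have UE : U^T = H^T + V^T by rewrite linearD.
rewrite LE UE /U -/V !(mulmxDl, mulmxDr) !mxtraceD quad cross.
by field.
Qed.

Theorem lemma4p2 (R : realType) (m n : nat) (A : 'M[int]_m)
    (hAsym : A^T = A) (hAdet : \det A != 0)
    (f : 'M[R]_(m, n) -> R)
    (hf : schwartz (fun U : 'M[R]_(m, n) =>
            f U * expR (- pi * \tr (U^T *m intmx R A *m U))))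
    (lambda : int) (H K : 'M[R]_(m, n))
    (S : 'M[int]_n) (hS : S^T = S) (Z : 'M[R[i]]_n) (hZ : siegel Z) :
  let Ktilde : 'M[R]_(m, n) :=
    K + H *m intmx R S
    + 2^-1 *: (invmx (intmx R A) *m diag_part R A *m const_mx 1
               *m diag_part R S) in
  theta A f lambda H K (Z + intmx R[i] S) =
  e2pi (- \tr (H^T *m intmx R A *m H *m intmx R S) / 2
        - \tr (diag_part R S *m (const_mx 1 : 'M[R]_(n, m)) *m diag_part R A
               *m H) / 2)%:C
  * theta A f lambda H Ktilde Z.
Proof.
move=> L; rewrite /theta; cbv zeta.
set c := e2pi (_ - _)%:C.
(* [S] is real, so the determinant factor and the arguments of [f] are unchanged. *)
have -> : immx (Z + intmx R[i] S) = immx Z.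
  apply/matrixP => i j; rewrite !mxE raddfD /= -[X in _ + X](_ : 0 = _) ?addr0 //.
  by rewrite -(rmorph_int (real_complex R)).
(* Moving the nonzero constant [c] inside the sum reduces the claim to an equality of terms. *)
rewrite mulrCA -(csumZ _ _ c) ?e2pi_neq0 //; congr (_ * csum _); apply/funext => N.
rewrite [RHS]mulrCA; congr (_ * _); rewrite -/c.
have [k Ek] := theta_phase_shift R _ _ A S H K N hAsym hAdet hS.
rewrite -/L in Ek.
set U := H + _ in Ek *.
have SE : intmx R[i] S = complexmx (intmx R S).
  by apply/matrixP => i j; rewrite !mxE rmorph_int.
rewrite mulmxDr SE -map_mxM mxtraceD trace_map_mx mulrDl.
(* The halving takes place in [R[i]], while [Ek] is an identity of real numbers. *)
have half (s : R) : s%:C / 2 = (s / 2)%:C.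
  by rewrite rmorphM fmorphV rmorph_nat.
rewrite half -addrA -(rmorphD (real_complex R)) Ek !(rmorphD (real_complex R)).
rewrite addrA e2piD e2pi_int mulr1 addrCA e2piD.
by rewrite -(rmorphD (real_complex R)).
Qed.
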